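(* Each of the following families of games is pet and forced: Bishop on the set of all nonempty partitions; Pawn on the set of all rectangles; Rook on the set of all staircases; Queen on the set of all staircases; Knight on the set of all staircases.
   Context: A partition is a finite weakly decreasing sequence $\lambda=[\lambda_1,\ldots,\lambda_r]$ of positive integers; $[\,]$ is the empty partition, and $\mathbb Y^+$ is the set of nonempty partitions. For $i,j\ge 0$, $\lambda[i,j]=[\lambda_{i+1}-j,\lambda_{i+2}-j,\ldots]$ with trailing nonpositive entries removed. For a moveset $M\subseteq \mathbb Z_{\ge0}^2\setminus\{(0,0)\}$ and $\lambda\in\mathbb Y^+$, the impartial chess game $(M,\lambda)$ starts at $\lambda$, and from a position $\mu\in\mathbb Y^+$ a player may move to $\mu[i,j]$ for any $(i,j)\in M$ with $\mu[i,j]\ne[\,]$. The positions of $(M,\lambda)$ are the partitions reachable from $\lambda$ by zero or more moves. A position is terminal if it has no moves. Movesets: Pawn $\{(0,1),(1,1)\}$; Knight $\{(1,2),(2,1)\}$; Bishop $\{(k,k):k\ge1\}$; Rook $\{(k,0):k\ge1\}\cup\{(0,k):k\ge1\}$; Queen $\{(k,0):k\ge1\}\cup\{(0,k):k\ge1\}\cup\{(k,k):k\ge1\}$. Rectangles are the partitions $[c^r]$ ($c$ repeated $r$ times), $r,c\ge1$; staircases are the partitions $[k,k-1,\ldots,1]$, $k\ge1$. The Sprague-Grundy value of a position $p$ is $\mathrm{mex}$ of the Sprague-Grundy values of the positions reachable in one move ($0$ if $p$ is terminal), where $\mathrm{mex}(S)$ is the least nonnegative integer not in $S$. The misère Grundy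 value is defined by the same mex recursion at non-terminal positions, but terminal positions have value $1$. A position with Sprague-Grundy value $t$ and misère Grundy value $\ell$ is called a $(t,\ell)$-position. A game is forced if each move from a $(0,1)$-position results in a $(1,0)$-position and each move from a $(1,0)$-position results in a $(0,1)$-position. A game is pet if it has only $(0,1)$-positions, $(1,0)$-positions, and $(k,k)$-positions with $k\ge2$. For a moveset $M$ and a set $P\subseteq\mathbb Y^+$, the family $(M,P)$ has one of these properties if $(M,\lambda)$ has it for every $\lambda\in P$. *)

(* Defs.v *)
From mathcomp Require Import all_boot.

Set Implicit Arguments.
Unset Strict Implicit.
Unset Printing Implicit Defensive.

Definition is_part (s : seq nat) : bool := sorted geq s && all (leq 1) s.

(* The set Y^+ of nonempty partitions. *)
Definition Yplus (s : seq nat) : Prop := is_part s /\ s <> [::].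

(* lambda[i,j]; in a weakly decreasing sequence the entries that truncate
   to 0 are exactly the trailing ones, so a filter removes them. *)
Definition subpart (s : seq nat) (i j : nat) : seq nat :=
  [seq x <- [seq y - j | y <- drop i s] | 0 < x].

Record moveset := Moveset {
  in_moveset :> pred (nat * nat);
  moveset00 : ~~ in_moveset (0, 0)
}.

Definition pmove (M : moveset) (s t : seq nat) : Prop :=
  exists i j, [/\ M (i, j), t = subpart s i j & t <> [::]].

Inductive position (M : moveset) (s : seq nat) : seq nat -> Prop :=
| position_start : position M s s
| position_step t u : position M s t -> pmove M t u -> position M s u.

(* The finite list of moves: (i, j) with i >= size s or j >= max s lead to the
   empty partition. *)
Definition options (M : moveset) (s : seq nat) : seq (seq nat) :=
  [seq t <- [seq subpart s ij.1 ij.2 |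
               ij <- [seq (i, j) | i <- iota 0 (size s),
                                   j <- iota 0 (foldr maxn 0 s)] & M ij]
  | t != [::]].

Definition mex (S : seq nat) : nat :=
  find (fun n => n \notin S) (iota 0 (size S).+1).

(* [e] is the value of terminal positions; [n] is fuel. *)
Fixpoint gval_rec (e : nat) (M : moveset) (n : nat) (s : seq nat) : nat :=
  if n is n'.+1 then
    if options M s is [::] then e
    else mex [seq gval_rec e M n' t | t <- options M s]
  else e.

(* A move to a nonempty sequence lowers [sumn s + size s], so the fuel
   suffices; see [gvalE]. *)
Definition gval (e : nat) (M : moveset) (s : seq nat) : nat :=
  gval_rec e M (sumn s + size s) s.

Definition sg_value (M : moveset) : seq nat -> nat := gval 0 M.
Definition misere_value (M : moveset) : seq nat -> nat := gval 1 M.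

Definition tl_position (M : moveset) (t l : nat) (s : seq nat) : Prop :=
  sg_value M s = t /\ misere_value M s = l.

Definition forced (M : moveset) (lam : seq nat) : Prop :=
  forall mu nu, position M lam mu -> pmove M mu nu ->
    (tl_position M 0 1 mu -> tl_position M 1 0 nu) /\
    (tl_position M 1 0 mu -> tl_position M 0 1 nu).

Definition pet (M : moveset) (lam : seq nat) : Prop :=
  forall mu, position M lam mu ->
    [\/ tl_position M 0 1 mu, tl_position M 1 0 mu |
        exists2 k, 2 <= k & tl_position M k k mu].

Definition family_has (G : moveset -> seq nat -> Prop)
    (M : moveset) (P : seq nat -> Prop) : Prop :=
  forall lam, P lam -> G M lam.

Definition rectangle (s : seq nat) : Prop :=
  exists r c, [/\ 1 <= r, 1 <= c & s = nseq r c].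

Definition staircase (s : seq nat) : Prop :=
  exists2 k, 1 <= k & s = rev (iota 1 k).

Definition pawn : moveset :=
  @Moveset [pred ij | (ij == (0, 1)) || (ij == (1, 1))] isT.
Definition knight : moveset :=
  @Moveset [pred ij | (ij == (1, 2)) || (ij == (2, 1))] isT.
Definition bishop : moveset :=
  @Moveset [pred ij | (1 <= ij.1) && (ij.1 == ij.2)] isT.
Definition rook : moveset :=
  @Moveset [pred ij | (1 <= ij.1) && (ij.2 == 0) ||
                      (ij.1 == 0) && (1 <= ij.2)] isT.
Definition queen : moveset :=
  @Moveset [pred ij | rook ij || bishop ij] isT.

Lemma mexP (S : seq nat) :
  mex S \notin S /\ (forall k, k < mex S -> k \in S).
Proof.
rewrite /mex; set r := iota _ _; set a := fun n => _.
have ha : has a r.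
  apply/negPn/negP => /hasPn h.
  have: size r <= size S.
    apply: uniq_leq_size; first exact: iota_uniq.
    by move=> x /h /negPn.
  by rewrite size_iota ltnn.
have lt := ha; rewrite has_find size_iota in lt.
split; first by have := nth_find 0 ha; rewrite nth_iota.
move=> k hk; have := before_find 0 hk.
by rewrite nth_iota ?(ltn_trans hk lt) // => /negbFE.
Qed.

Lemma foldr_maxn_ge (s : seq nat) x : x \in s -> x <= foldr maxn 0 s.
Proof.
elim: s => //= y s IH; rewrite inE => /orP[/eqP->|/IH h].
  exact: leq_maxl.
exact: leq_trans h (leq_maxr _ _).
Qed.

Lemma optionsP (M : moveset) (s t : seq nat) :
  reflect (pmove M s t) (t \in options M s).
Proof.
apply: (iffP idP).
  rewrite mem_filter => /andP[/eqP tn /mapP[[i j]]].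
  by rewrite mem_filter => /andP[Mij _] te; exists i, j.
case=> i [j [Mij te tn]]; rewrite mem_filter; apply/andP; split; first exact/eqP.
apply/mapP; exists (i, j) => //; rewrite mem_filter Mij /=.
case: t te tn => // x t te _.
have: x \in subpart s i j by rewrite -te mem_head.
rewrite mem_filter => /andP[x0 /mapP[y ys xe]].
apply: allpairs_f; rewrite mem_iota /= ?add0n.
  by rewrite ltnNge; apply/negP => /drop_oversize d; rewrite d in ys.
apply: leq_trans (foldr_maxn_ge (mem_drop ys)).
by rewrite -subn_gt0 -xe.
Qed.

Lemma subpart_mass (s : seq nat) (i j : nat) :
  sumn (subpart s i j) + size (subpart s i j) <= sumn (drop i s) + size (drop i s)
  /\ (0 < j -> subpart s i j <> [::] ->
      sumn (subpart s i j) + size (subpart s i j)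
        < sumn (drop i s) + size (drop i s)).
Proof.
rewrite /subpart; elim: (drop i s) => //= y d [IH1 IH2].
rewrite subn_gt0; case: ltnP => [yj|yj] /=; last first.
  split.
    apply: leq_trans IH1 _.
    by apply: leq_add; [exact: leq_addl | exact: leqnSn].
  move=> j0 n0; apply: leq_trans (IH2 j0 n0) _.
  by apply: leq_add; [exact: leq_addl | exact: leqnSn].
rewrite !addnS !ltnS -!addnA; split; first by rewrite leq_add ?leq_subr.
by move=> j0 _; rewrite -addSn leq_add // ltn_subrL j0 (leq_ltn_trans _ yj).
Qed.

Lemma pmove_mass (M : moveset) (s t : seq nat) :
  pmove M s t -> sumn t + size t < sumn s + size s.
Proof.
case=> i [j [Mij -> tn]].
have [le1 lt1] := subpart_mass s i j.
have sE : sumn s + size s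
    = (sumn (take i s) + size (take i s)) + (sumn (drop i s) + size (drop i s)).
  by rewrite -{1 2}(cat_take_drop i s) sumn_cat size_cat addnACA.
have [j0|j0] := posnP j; last first.
  by rewrite sE (leq_trans (lt1 j0 tn)) // leq_addl.
have i0 : 0 < i.
  by case: i Mij {tn le1 lt1 sE} => //; rewrite j0 (negbTE (moveset00 M)).
rewrite sE; apply: leq_ltn_trans le1 _; rewrite -[X in X < _]add0n ltn_add2r.
case: s tn {lt1 sE} => [|x s _]; first by rewrite /subpart.
by case: i i0 {Mij} => //= i _; rewrite addnS.
Qed.

Lemma gvalE (e : nat) (M : moveset) (s : seq nat) :
  gval e M s = if options M s is [::] then e
               else mex [seq gval e M t | t <- options M s].
Proof.
have irr n1 n2 u : sumn u + size u <= n1 -> sumn u + size u <= n2 ->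
    gval_rec e M n1 u = gval_rec e M n2 u.
  elim: n1 n2 u => [|n1 IH] [|n2] u //=.
  - by rewrite leqn0 addn_eq0 size_eq0 => /andP[_ /eqP->].
  - by move=> _; rewrite leqn0 addn_eq0 size_eq0 => /andP[_ /eqP->].
  move=> h1 h2; case E: (options M u) => [//|v o]; rewrite -E.
  congr mex; apply/eq_in_map => t /optionsP /pmove_mass lt.
  by apply: IH; rewrite -ltnS; [apply: leq_trans h1 | apply: leq_trans h2].
rewrite {1}/gval (irr _ (sumn s + size s).+1 _ (leqnn _) (leqnSn _)) /=.
case E: (options M s) => [//|v o]; rewrite -E.
congr mex; apply/eq_in_map => t /optionsP /pmove_mass lt.
by apply: irr => //; apply: ltnW.
Qed.

Lemma subpart_is_part (s : seq nat) (i j : nat) :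
  is_part s -> is_part (subpart s i j).
Proof.
case/andP=> srt _; apply/andP; split; last exact: filter_all.
have tr : transitive geq by move=> y x z /= h1 h2; apply: leq_trans h2 h1.
apply: (sorted_filter tr).
apply: (homo_sorted (e := geq)); last exact: (subseq_sorted tr (drop_subseq _ _)).
by move=> x y /= h; apply: leq_sub2r.
Qed.

Lemma position_Yplus (M : moveset) (s t : seq nat) :
  Yplus s -> position M s t -> Yplus t.
Proof.
move=> sY; elim=> // u v _ [uP _] [i [j [_ -> n0]]].
by split=> //; apply: subpart_is_part.
Qed.

Lemma rectangle_Yplus (s : seq nat) : rectangle s -> Yplus s.
Proof.
case=> [[|r] [c [// _ c0 ->]]]; split=> //; apply/andP; split.
  by elim: r => //= r IH; rewrite leqnn.
by rewrite all_nseq c0 orbT.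
Qed.

Lemma staircase_Yplus (s : seq nat) : staircase s -> Yplus s.
Proof.
case=> [[|k] // _ ->]; split; last by move/(congr1 size); rewrite size_rev.
apply/andP; split; first by rewrite rev_sorted iota_sorted.
by rewrite all_rev; apply/allP => x; rewrite mem_iota => /andP[].
Qed.

(* Main.v *)
Require Import Defs.
From mathcomp Require Import all_boot.

Set Implicit Arguments.
Unset Strict Implicit.
Unset Printing Implicit Defensive.

(** On each family the Sprague-Grundy value is an explicit rank [r]: a move
    never preserves the rank, every smaller rank can be reached, and from rank
    at most 1 the players alternate between ranks 0 and 1.  These conditions
    force the misère value to be [r] with 0 and 1 exchanged.  Bishop, Rook and
    Queen are Nim heaps in disguise: a bishop move by k shortens the main
    diagonal by k, and a move (i, j) turns the staircase of size n into the
    one of size n - i - j.  For Pawn and Knight every move lowers the same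
    quantity (the width, resp. a third of the size) by one, and the rank is
    its parity. *)

Definition swap01 (n : nat) : nat := if n <= 1 then 1 - n else n.

Lemma swap01K : involutive swap01.
Proof. by case=> [|[|n]]. Qed.

Lemma mex_eq (S : seq nat) v :
  v \notin S -> (forall k, k < v -> k \in S) -> mex S = v.
Proof.
move=> vS ltS; have [mS ltmS] := mexP S.
case: (ltngtP (mex S) v) => [/ltS|/ltmS|//]; first by rewrite (negbTE mS).
by rewrite (negbTE vS).
Qed.

(** * Both Grundy values from a rank function *)

Section Rank.

Variables (M : moveset) (P : seq nat -> Prop) (r : seq nat -> nat).
Hypothesis P_move : forall s t, P s -> pmove M s t -> P t.
Hypothesis r_move : forall s t, P s -> pmove M s t -> r t <> r s.
Hypothesis r_mex : forall s m, P s -> m < r s -> exists2 t, pmove M s t & r t = m.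
Hypothesis r_alt : forall s t, P s -> pmove M s t -> r s <= 1 -> r t = 1 - r s.

(** By induction on the mass that every move lowers, both sets of option values are known: the ranks
    of the options, and their images under [swap01]. The first mex is [r s] by [r_move] and [r_mex].
    For the second, [swap01] permutes the numbers below any rank that is at least 2, so only ranks 0
    and 1 need care. *)
Lemma gval_rank s : P s -> sg_value M s = r s /\ misere_value M s = swap01 (r s).
Proof.
move=> Ps; have [n] := ubnP (sumn s + size s).
elim: n s Ps => // n IH s Ps; rewrite ltnS => sn.
have {}IH t : pmove M s t -> gval 0 M t = r t /\ gval 1 M t = swap01 (r t).
  by move=> st; exact: IH (P_move Ps st) (leq_trans (pmove_mass st) sn).
rewrite /sg_value /misere_value !gvalE.
case E: (options M s) => [|u o].
  (* A positive rank would give a move, by [r_mex] with m = 0. *)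
  suff -> : r s = 0 by [].
  by have [|/(r_mex Ps)[t /optionsP]] := posnP (r s); rewrite ?E.
have su : pmove M s u by apply/optionsP; rewrite E mem_head.
rewrite -E {E o}; split; apply: mex_eq => [|k].
- by apply/negP => /mapP[t /optionsP st]; rewrite (IH t st).1 => /esym/(r_move Ps st).
- move=> /(r_mex Ps)[t st <-]; apply/mapP; exists t; first exact/optionsP.
  by rewrite (IH t st).1.
- apply/negP => /mapP[t /optionsP st]; rewrite (IH t st).2.
  by move=> /(can_inj swap01K)/esym/(r_move Ps st).
(* A non-terminal position of rank 0 must have an option of misère value 0; by [r_alt] every option
   has rank 1, so any one serves. *)
have [rs0|rs_gt0] := posnP (r s).
  rewrite rs0 ltnS leqn0 => /eqP->; apply/mapP; exists u; first exact/optionsP.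
  by rewrite (IH u su).2 (r_alt Ps su) rs0.
move=> kr; have /(r_mex Ps)[t st rt] : swap01 k < r s.
  by move: kr rs_gt0; rewrite /swap01; case: (r s) => [|[|m]] //; case: k => [|[]].
by apply/mapP; exists t; [apply/optionsP | rewrite (IH t st).2 rt swap01K].
Qed.

Lemma position_inv s t : P s -> position M s t -> P t.
Proof. by move=> Ps; elim=> // u v _ Pu /(P_move Pu). Qed.

Lemma pet_forced_rank : family_has pet M P /\ family_has forced M P.
Proof.
split=> [s Ps t /(position_inv Ps) Pt | s Ps t u /(position_inv Ps) Pt tu].
  have := gval_rank Pt; case: (r t) => [|[|n]] h; [exact: Or31 | exact: Or32 |].
  by apply: Or33; exists n.+2.
have [tE _] := gval_rank Pt; have uE := gval_rank (P_move Pt tu).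
by split=> -[rt _]; rewrite rt in tE; rewrite (r_alt Pt tu) -tE in uE.
Qed.

End Rank.

Section NimRank.

Variables (M : moveset) (P : seq nat -> Prop) (r : seq nat -> nat).
Hypothesis P_move : forall s t, P s -> pmove M s t -> P t.
Hypothesis r_lt : forall s t, P s -> pmove M s t -> r t < r s.
Hypothesis r_mex : forall s m, P s -> m < r s -> exists2 t, pmove M s t & r t = m.

(** Strict decrease makes the alternation automatic: rank 0 admits no move, and rank 1 leads only to
    rank 0. *)
Lemma pet_forced_nim : family_has pet M P /\ family_has forced M P.
Proof.
apply: pet_forced_rank P_move _ r_mex _ => s t Ps /(r_lt Ps).
  by move=> + e; rewrite e ltnn.
by case: (r s) => [|[|]] //; case: (r t).
Qed.

End NimRank.

Section ParityRank.

Variables (M : moveset) (P : seq nat -> Prop) (r : seq nat -> nat).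
Hypothesis P_move : forall s t, P s -> pmove M s t -> P t.
Hypothesis r_pred : forall s t, P s -> pmove M s t -> r s = (r t).+1.
Hypothesis r_pos : forall s, P s -> 0 < r s -> exists t, pmove M s t.

(** Each move flips the parity of [r], and the only value below parity 1 is 0, reached by any move;
    an odd [r] is positive, so a move exists. *)
Lemma pet_forced_parity : family_has pet M P /\ family_has forced M P.
Proof.
apply: (@pet_forced_rank M P (fun s => odd (r s)) P_move) => [s t|s m|s t] Ps.
- by move=> /(r_pred Ps) -> /=; case: odd.
- have [-> //|rs] := posnP (r s); have [t st] := r_pos Ps rs => mr.
  by exists t => //; move: mr; rewrite (r_pred Ps st) /=; case: odd m => [] [].
- by move=> /(r_pred Ps) -> /=; case: odd.
Qed.

End ParityRank.

(** * Bishop: entries of partitions and the Durfee square *)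

Lemma geq_trans : transitive geq.
Proof. by move=> y x z /= xy yz; apply: leq_trans yz xy. Qed.

(** The zeros of a weakly decreasing sequence form a tail, and reading past the end returns the
    default 0 anyway. *)
Lemma nth_filter_pos (s : seq nat) m :
  sorted geq s -> nth 0 [seq x <- s | 0 < x] m = nth 0 s m.
Proof.
elim: s m => //= x s IH m xs; have ss := path_sorted xs.
have [x0|x0] := posnP x; last by case: m => //= m; rewrite IH.
rewrite IH //; move: xs; rewrite x0 (path_sortedE geq_trans) => /andP[/allP s0 _].
have z k : nth 0 s k = 0.
  have [/(nth_default 0)//|/(mem_nth 0)/s0] := leqP (size s) k.
  by rewrite /= leqn0 => /eqP.
by case: m => [|m]; rewrite /= !z.
Qed.

Lemma nth_part_geq (s : seq nat) i j :
  sorted geq s -> i <= j -> nth 0 s j <= nth 0 s i.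
Proof.
move=> ss ij; have [/(nth_default 0)->//|js] := leqP (size s) j.
by apply: (sorted_leq_nth geq_trans leqnn 0 ss) => //; apply: leq_ltn_trans ij js.
Qed.

Lemma nth_subpart (s : seq nat) i j m :
  is_part s -> nth 0 (subpart s i j) m = nth 0 s (i + m) - j.
Proof.
move=> /andP[ss _]; rewrite nth_filter_pos.
  have [sm|sm] := leqP (size (drop i s)) m.
    rewrite !nth_default ?size_map //.
    by rewrite -leq_subLR -size_drop.
  by rewrite (nth_map 0) // nth_drop.
apply: (homo_sorted (e := geq)); last first.
  exact: subseq_sorted geq_trans _ _ (drop_subseq _ _) ss.
by move=> x y /= h; apply: leq_sub2r.
Qed.

(** The side of the Durfee square, that is, the length of the main diagonal of the Young diagram.
    The index [size s] always passes the test, through the default 0. *)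
Definition diag (s : seq nat) : nat :=
  find (fun k => nth 0 s k <= k) (iota 0 (size s).+1).

Lemma ltn_diag (s : seq nat) k : is_part s -> (k < diag s) = (k < nth 0 s k).
Proof.
move=> /andP[ss _]; set a := fun k => nth 0 s k <= k.
have ha : has a (iota 0 (size s).+1).
  apply/hasP; exists (size s); first by rewrite mem_iota /= add0n.
  by rewrite /a nth_default.
have lt : diag s < (size s).+1 by rewrite -[X in _ < X](size_iota 0) -has_find.
have [kd|dk] := ltnP k (diag s).
  have := before_find 0 kd; rewrite (nth_iota 0 0 (ltn_trans kd lt)) => nk.
  by rewrite ltnNge nk.
apply/esym/negbTE; rewrite -leqNgt.
apply: leq_trans (nth_part_geq ss dk) _; apply: leq_trans dk.
by have := nth_find 0 ha; rewrite -/(diag s) nth_iota.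
Qed.

(** The diagonal cell [m] of the new diagram is the diagonal cell [k + m] of the old one. *)
Lemma diag_subpart (s : seq nat) k :
  is_part s -> diag (subpart s k k) = diag s - k.
Proof.
move=> sP; have tP := subpart_is_part k k sP.
have lt m : (m < diag (subpart s k k)) = (m < diag s - k).
  by rewrite ltn_subRL !ltn_diag // nth_subpart // ltn_subRL.
case: (ltngtP (diag (subpart s k k)) (diag s - k)) => //.
  by rewrite -lt ltnn.
by rewrite lt ltnn.
Qed.

Lemma diag_gt0 (s : seq nat) : is_part s -> (0 < diag s) = (s != [::]).
Proof. by move=> sP; rewrite ltn_diag //; case: s sP => //= x s /andP[_ /andP[]]. Qed.

Lemma pet_forced_bishop :
  family_has pet bishop Yplus /\ family_has forced bishop Yplus.
Proof.
(* The heap is one less than the diagonal because a move may not empty the partition. *)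
apply: (@pet_forced_nim _ _ (fun s => (diag s).-1)) => [s t|s t|s m] [sP s0].
- by case=> i [j [_ -> t0]]; split=> //; apply: subpart_is_part.
- case=> i [j [/= /andP[i0 /eqP <-] -> /eqP]].
  rewrite -diag_gt0 ?subpart_is_part // diag_subpart // subn_gt0 => id.
  by rewrite ltn_predRL prednK ?subn_gt0 // ltn_subrL i0 (leq_ltn_trans _ id).
- rewrite ltn_predRL => md; pose k := diag s - m.+1.
  have dE : diag (subpart s k k) = m.+1 by rewrite diag_subpart // subKn // ltnW.
  exists (subpart s k k); last by rewrite dE.
  exists k, k; split=> //=; first by rewrite eqxx subn_gt0 md.
  by apply/eqP; rewrite -diag_gt0 ?subpart_is_part // dE.
Qed.

(** * Pawn on rectangles *)

Lemma subpart_nseq (n c i j : nat) :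
  subpart (nseq n c) i j = if j < c then nseq (n - i) (c - j) else [::].
Proof.
rewrite /subpart drop_nseq map_nseq filter_nseq subn_gt0.
by case: ifP; rewrite ?mul1n ?mul0n.
Qed.

Lemma pet_forced_pawn :
  family_has pet pawn rectangle /\ family_has forced pawn rectangle.
Proof.
(* Both pawn moves narrow the rectangle by exactly one column; the number of rows does not enter the
   rank. *)
have move_rect n c t : pmove pawn (nseq n c) t ->
    exists i, [/\ 1 < c, 0 < n - i & t = nseq (n - i) c.-1].
  case=> i [j [/= ij -> ]]; rewrite subpart_nseq; case: ifP => // jc t0; exists i.
  have j1 : j = 1 by case/orP: ij => /eqP[].
  rewrite j1 in jc t0 *; rewrite subn1 in t0 *; split=> //.
  by case: (n - i) t0.
apply: (@pet_forced_parity _ _ (fun s => (head 0 s).-1)) => [s t|s t|s].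
- move=> [n [c [_ _ ->]]] /move_rect[i [c1 ni ->]].
  by exists (n - i), c.-1; rewrite ltn_predRL.
- move=> [n [c [n0 _ ->]]] /move_rect[i [c1 ni ->]].
  by case: n n0 ni => // n _; case: (_ - i) => // m _; case: c c1 => [|[]].
- move=> [[|n] [c [// _ _ ->]]] /=; rewrite ltn_predRL => c1.
  (* The move (0, 1) keeps all rows, so it is legal even on a single row. *)
  exists (subpart (nseq n.+1 c) 0 1); exists 0, 1; split=> //.
  by rewrite subpart_nseq c1.
Qed.

(** * Rook, Queen and Knight on staircases *)

Lemma subpart_staircase (n i j : nat) :
  subpart (rev (iota 1 n)) i j = rev (iota 1 (n - i - j)).
Proof.
rewrite /subpart drop_rev size_iota take_iota map_rev filter_rev; congr rev.
rewrite (minn_idPl (leq_subr i n)); move: (n - i) => {n i} m.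
have low k : k <= j -> [seq x <- [seq y - j | y <- iota 1 k] | 0 < x] = [::].
  move=> kj; apply/eqP; rewrite -[_ == _]negbK -has_filter; apply/hasPn => x.
  case/mapP=> y; rewrite mem_iota add1n ltnS => /andP[_ yk] ->.
  by rewrite subn_gt0 -leqNgt (leq_trans yk).
have [mj|/ltnW jm] := leqP m j; first by rewrite low //; move: mj => /eqP->.
(* The entries up to [j] vanish; the others are [iota 1 (m - j)] shifted by [j], and the subtraction
   undoes the shift. *)
rewrite -{1}(subnKC jm) iotaD map_cat filter_cat low //= addnC iotaDl -map_comp.
rewrite (eq_map (g := id)) ?map_id => [|x /=]; last by rewrite addKn.
by apply/all_filterP/allP => x; rewrite mem_iota => /andP[].
Qed.

Lemma pmove_staircase (M : moveset) (n : nat) (t : seq nat) :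
  pmove M (rev (iota 1 n)) t <->
  exists i j, [/\ M (i, j), i + j < n & t = rev (iota 1 (n - (i + j)))].
Proof.
split=> -[i [j [Mij]]]; rewrite ?subpart_staircase ?subnDA.
  move=> -> t0; exists i, j; split; rewrite ?subnDA //.
  by rewrite -subn_gt0 subnDA; case: (_ - j) t0.
move=> lt ->; exists i, j; rewrite subpart_staircase; split=> //.
move/(congr1 size); rewrite size_rev size_iota -subnDA => /eqP.
by rewrite subn_eq0 leqNgt lt.
Qed.

Lemma staircase_move (M : moveset) (s t : seq nat) :
  staircase s -> pmove M s t -> staircase t.
Proof.
move=> [n _ ->] /pmove_staircase[i [j [_ lt ->]]].
by exists (n - (i + j)); rewrite // subn_gt0.
Qed.

Lemma moveset_gt0 (M : moveset) i j : M (i, j) -> 0 < i + j.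
Proof. by case: i j => [|i] [|j] //; rewrite (negbTE (moveset00 M)). Qed.

(** Deleting rows already reaches every smaller staircase, and all other moves also land on smaller
    staircases, so the game is a Nim heap of size n - 1. *)
Lemma pet_forced_staircase_nim (M : moveset) :
  (forall k, 0 < k -> M (k, 0)) ->
  family_has pet M staircase /\ family_has forced M staircase.
Proof.
move=> Mk; apply: (@pet_forced_nim _ _ (fun s => (size s).-1)).
- exact: staircase_move.
- move=> s t [n _ ->] /pmove_staircase[i [j [/moveset_gt0 k0 lt ->]]].
  rewrite !size_rev !size_iota.
  by rewrite ltn_predRL prednK ?subn_gt0 // ltn_subrL k0 (leq_ltn_trans _ lt).
- move=> s m [n n0 ->]; rewrite size_rev size_iota ltn_predRL => mn.
  exists (rev (iota 1 m.+1)); last by rewrite size_rev size_iota.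
  apply/pmove_staircase; exists (n - m.+1), 0; rewrite addn0 (subKn (ltnW mn)).
  by split=> //; [rewrite Mk ?subn_gt0 | rewrite ltn_subrL].
Qed.

Lemma pet_forced_knight :
  family_has pet knight staircase /\ family_has forced knight staircase.
Proof.
(* Both knight moves have i + j = 3 and need n > 3, so this quotient counts the moves left. *)
apply: (@pet_forced_parity _ _ (fun s => (size s).-1 %/ 3)).
- exact: staircase_move.
- move=> s t [n _ ->] /pmove_staircase[i [j [/= Mij lt ->]]].
  have ij : i + j = 3 by case/orP: Mij => /eqP[-> ->].
  rewrite ij in lt *; rewrite !size_rev !size_iota.
  by case: n lt => [|[|[|[|n]]]] // _; rewrite -[_.+4.-1]/(3 + n) divnDl.
- move=> s [n _ ->]; rewrite size_rev size_iota divn_gt0 // => n3.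
  exists (rev (iota 1 (n - 3))); apply/pmove_staircase; exists 1, 2.
  by split=> //; case: n n3.
Qed.

Theorem theorem4p8 :
  [/\ family_has pet bishop Yplus /\ family_has forced bishop Yplus,
      family_has pet pawn rectangle /\ family_has forced pawn rectangle,
      family_has pet rook staircase /\ family_has forced rook staircase,
      family_has pet queen staircase /\ family_has forced queen staircase
    & family_has pet knight staircase /\ family_has forced knight staircase].
Proof.
split.
- exact: pet_forced_bishop.
- exact: pet_forced_pawn.
- by apply: pet_forced_staircase_nim => k /= ->.
- by apply: pet_forced_staircase_nim => k /= ->.
- exact: pet_forced_knight.
Qed.
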